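(* An Abelian group $G$ is absolutely generalized Bassian if and only if exactly one of the following two conditions holds: (1) $G$ is a torsion group such that, for each prime $p$, $T_p$ is elementary or finite; (2) $G$ is a Bassian non-torsion group.
   Context: All groups are Abelian, written additively. An injection between groups means an injective homomorphism. $T = T(G)$ is the maximal torsion subgroup of $G$ and $T_p$ is its $p$-primary component; $T_p$ is elementary if $pT_p = \{0\}$. A group $G$ is Bassian if, for every subgroup $N \leq G$, the existence of an injection $G \to G/N$ implies $N = \{0\}$. For a subgroup $A \leq G$, a subgroup $V \leq G$ is $A$-high if it is maximal with respect to $V \cap A = \{0\}$. A subgroup $A$ of $G$ is an absolute direct summand of $G$ if $G = A \oplus V$ for every $A$-high subgroup $V$ of $G$. A group $G$ is absolutely generalized Bassian if, for every subgroup $H \leq G$, the existence of an injection $G \to G/H$ implies that $H$ is an absolute direct summand of $G$. *)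

(* Defs.v *)
From HB Require Import structures.
From mathcomp Require Import all_boot all_algebra.
From mathcomp Require Import boolp classical_sets cardinality.

Set Implicit Arguments.
Unset Strict Implicit.
Unset Printing Implicit Defensive.

Import GRing.Theory.
Local Open Scope ring_scope.
Local Open Scope classical_set_scope.

(* An abelian group is a zmodType and a subgroup of G is a zmodClosed G, with
   the library quotient {quot N}.  Membership in a zmodClosed is boolean; this
   is no restriction, since the classical axioms of boolp turn every
   Prop-valued subgroup into a boolean one (asbool). *)
Notation "{ 'quot' N }" := (@Quotient.quot _ N)
  (format "{ 'quot'  N }") : type_scope.

Definition injects (G H : zmodType) : Prop :=
  exists f : {additive G -> H}, injective f.

Section Groups.
Variable G : zmodType.

Definition trivial_subgroup (N : zmodClosed G) : Prop := N =i pred1 0.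

Definition trivial_meet (V A : zmodClosed G) : Prop :=
  [predI V & A] =i pred1 0.

Definition high (A V : zmodClosed G) : Prop :=
  trivial_meet V A /\
  forall W : zmodClosed G,
    {subset V <= W} -> trivial_meet W A -> W =i V.

Definition direct_sum (A V : zmodClosed G) : Prop :=
  trivial_meet A V /\
  forall x : G, exists a v : G, [/\ a \in A, v \in V & x = a + v].

Definition absolute_direct_summand (A : zmodClosed G) : Prop :=
  forall V : zmodClosed G, high A V -> direct_sum A V.

Definition torsion_part : set G :=
  [set x | exists n : nat, (0 < n)%N /\ x *+ n = 0].

Definition primary_component (p : nat) : set G :=
  [set x | torsion_part x /\ exists k : nat, x *+ (p ^ k)%N = 0].

Definition elementary_component (p : nat) : Prop :=
  [set x *+ p | x in primary_component p] = [set 0].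

End Groups.

Arguments torsion_part G : clear implicits.
Arguments primary_component G p : clear implicits.
Arguments elementary_component G p : clear implicits.

Definition torsion_group (G : zmodType) : Prop := torsion_part G = setT.

Definition Bassian (G : zmodType) : Prop :=
  forall N : zmodClosed G, injects G {quot N} -> trivial_subgroup N.

Definition absolutely_generalized_Bassian (G : zmodType) : Prop :=
  forall H : zmodClosed G, injects G {quot H} -> absolute_direct_summand H.

Definition torsion_elementary_or_finite (G : zmodType) : Prop :=
  torsion_group G /\
  forall p : nat, prime p ->
    elementary_component G p \/ finite_set (primary_component G p).

Definition Bassian_nontorsion (G : zmodType) : Prop :=
  Bassian G /\ ~ torsion_group G.

(* Main.v *)
Require Import Defs.
From HB Require Import structures.
From mathcomp Require Import all_boot all_order all_algebra zify ring.
From mathcomp Require Import boolp classical_sets cardinality.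

(* Let K be the set of subgroups H such that G embeds in G/H.  If every member of
   K is an absolute direct summand, then K is closed under subgroups, since G
   embeds in a complement of each H in K.  An absolute direct summand A cannot
   contain an element e outside pA if some x satisfies ann(px mod A) <= ann(px - e):
   an A-high subgroup containing px - e would not be a complement.  Applied to a
   cyclic A in K, this gives A = 0 when G is not torsion, and T_p elementary when
   A has order p.

   It remains to find an H in K with p-torsion whenever T_p is infinite.  If the
   socle of T_p is finite, then p^k T_p is a nonzero divisible group D for large
   k, and H = D[p] works.  Otherwise T_p contains a direct sum C of cyclic groups
   that has a non-injective map s onto, and an injective map j into, E[N], where
   E is a countable direct sum of quasi-cyclic groups.  Here either N = 0 and the
   orders of the summands are unbounded, or N = p^m is their common order and C
   meets NG trivially.  By the injectivity of E both maps extend to G, killing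
   NG, and H = C cap ker s works.

   Conversely, if T_p is finite then every H in K meets it trivially by counting,
   so any H-high subgroup contains T_p; if T_p is elementary, then the sum of H
   and any H-high subgroup contains T_p. *)

Set Implicit Arguments.
Unset Strict Implicit.
Unset Printing Implicit Defensive.

Import Order.TTheory GRing.Theory Num.Theory.
Local Open Scope ring_scope.
Local Open Scope classical_set_scope.
Local Open Scope quotient_scope.

(** * Subgroups as predicates *)

Definition is_subgroup (G : zmodType) (S : set G) : Prop :=
  S 0 /\ forall x y, S x -> S y -> S (x - y).

Section Subgroups.
Variables (G : zmodType) (S : set G) (sgS : is_subgroup S).

Lemma subgroupN x : S x -> S (- x).
Proof. by move=> Sx; rewrite -sub0r; apply sgS.2 => //; apply sgS.1. Qed.

Lemma subgroupD x y : S x -> S y -> S (x + y).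
Proof.
by move=> Sx Sy; rewrite -[y]opprK; apply sgS.2 => //; apply: subgroupN.
Qed.

Lemma subgroupMn x n : S x -> S (x *+ n).
Proof.
move=> Sx; elim: n => [|n IHn]; first by rewrite mulr0n; apply sgS.1.
by rewrite mulrS; apply: subgroupD.
Qed.

Lemma subgroupMz x (n : int) : S x -> S (x *~ n).
Proof.
move=> Sx; case: n => n; first exact: subgroupMn.
by rewrite NegzE mulrNz; apply/subgroupN/subgroupMn.
Qed.

End Subgroups.

Lemma zmodClosed_of_subgroup (G : zmodType) (S : set G) :
  is_subgroup S -> exists N : zmodClosed G, forall x, x \in N <-> S x.
Proof.
move=> [S0 SB]; pose S' : {pred G} := fun x => `[< S x >].
have S'P : zmod_closed S'.
  split=> [|x y]; first by apply/asboolP.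
  by move=> /asboolP Sx /asboolP Sy; apply/asboolP; apply: SB.
pose S'M := GRing.isZmodClosed.Build G S' S'P.
exists (HB.pack S' S'M : zmodClosed G) => x.
by split=> [/asboolP|Sx] //; apply/asboolP.
Qed.

Lemma subgroup_zmodClosed (G : zmodType) (N : zmodClosed G) :
  is_subgroup [set x | x \in N].
Proof. by split=> [|x y] /=; [exact: rpred0 | exact: rpredB]. Qed.

Lemma subgroup_multiples (G : zmodType) (e : G) :
  is_subgroup [set x | exists k : int, x = e *~ k].
Proof.
split=> [|x y [k ->] [l ->]]; first by exists 0; rewrite mulr0z.
by exists (k - l); rewrite mulrzBr.
Qed.

Lemma zorn_subgroup (G : zmodType) (W bad : set G) :
  is_subgroup W -> (forall x, W x -> ~ bad x) ->
  exists V : set G, [/\ is_subgroup V, W `<=` V, forall x, V x -> ~ bad x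
    & forall U : set G, is_subgroup U -> V `<=` U ->
        (forall x, U x -> ~ bad x) -> U `<=` V].
Proof.
move=> sgW Wbad.
(* The empty chain has empty union; joining [W] makes it admissible. *)
pose P := [set X : set G | is_subgroup (W `|` X) /\
                           forall x, (W `|` X) x -> ~ bad x].
have [|A [[sgA Abad] Amax]] := @Zorn_bigcup G P.
  move=> F FP Ftot.
  have pair x y : (W `|` \bigcup_(X in F) X) x ->
      (W `|` \bigcup_(X in F) X) y ->
      (W x /\ W y) \/ exists2 X, F X & (W `|` X) x /\ (W `|` X) y.
    move=> [Wx|[X FX Xx]] [Wy|[Y FY Yy]]; first by left.
    - by right; exists Y => //; split; [left|right].
    - by right; exists X => //; split; [right|left].
    - case: (Ftot _ _ FX FY) => sub; right.
      + by exists Y => //; split; right => //; apply: sub.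
      + by exists X => //; split; right => //; apply: sub.
  split; first split; first by left; apply sgW.1.
    move=> x y hx hy; case: (pair _ _ hx hy) => [[Wx Wy]|[X FX [Xx Xy]]].
      by left; apply sgW.2.
    case: ((FP _ FX).1.2 _ _ Xx Xy) => [|h]; first by left.
    by right; exists X.
  by move=> x [/Wbad//|[X FX Xx]]; apply: (FP _ FX).2; right.
exists (W `|` A); split=> // U sgU subU Ubad x Ux.
apply: contrapT => nVx; apply: (Amax U).
  split; first by move=> y Ay; apply: subU; right.
  by move=> subA; apply: nVx; right; apply: subA.
have -> : P U = (is_subgroup (W `|` U) /\ forall x, (W `|` U) x -> ~ bad x) by [].
have -> // : W `|` U = U by apply/setUidPr => y Wy; apply: subU; left.
Qed.

(** * Homomorphisms into divisible groups *)

(** Compatibility with differences reduces single-valuedness to the value at [0], so any choice of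
    values is additive. *)
Lemma additive_of_relation (G E : zmodType) (R : G -> E -> Prop) :
  (forall x, exists y, R x y) ->
  (forall x x' y y', R x y -> R x' y' -> R (x - x') (y - y')) ->
  (forall y, R 0 y -> y = 0) ->
  exists f : {additive G -> E}, forall x, R x (f x).
Proof.
move=> tot sub fn; have [f fR] := choice tot.
have fB : zmod_morphism f.
  move=> x y; apply/eqP; rewrite -subr_eq0; apply/eqP/fn.
  rewrite -(subrr (x - y)); exact: (sub _ _ _ _ (fR _) (sub _ _ _ _ (fR x) (fR y))).
pose fM := GRing.isZmodMorphism.Build G E f fB.
by exists (HB.pack f fM : {additive G -> E}).
Qed.

Definition divisible_set (E : zmodType) (D : set E) : Prop :=
  forall n x, (0 < n)%N -> D x -> exists2 y, D y & x = y *+ n.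

(** These integers form an ideal, generated by its least positive member, or by [0] when [x] has
    infinite order modulo [S]. *)
Lemma order_mod_subgroup (G : zmodType) (S : set G) (x : G) :
  is_subgroup S -> exists d : nat, forall n : int, S (x *~ n) <-> (d %| n)%Z.
Proof.
move=> sgS.
case: (pselect (exists n : nat, (0 < n)%N && `[< S (x *+ n) >])) => [ex|nex].
  have := ex_minnP ex; case=> d /andP[d0 /asboolP Sd] dmin; exists d => n.
  split=> [Sn|/dvdzP[q ->]]; last first.
    by rewrite (mulrC q) mulrzA; apply: subgroupMz.
  have : S (x *~ (n %% d)%Z).
    have -> : x *~ (n %% d)%Z = x *~ n - (x *+ d) *~ (n %/ d)%Z.
      by rewrite /modz mulrzBr (mulrC _ d%:Z) mulrzA.
    by apply sgS.2 => //; apply: subgroupMz.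
  have r0 : (0 <= (n %% d)%Z)%R by apply: modz_ge0; rewrite eqz_nat -lt0n.
  have := ltz_pmod n (_ : (0 < d%:Z)%R); rewrite ltz_nat => /(_ d0).
  rewrite /dvdz; case E : (n %% d)%Z r0 => [r|r] // _.
  rewrite ltz_nat => rd Sr; apply/dvdz_mod0P; rewrite E.
  case: r E rd Sr => [//|r] E rd Sr.
  have : (d <= r.+1)%N by apply: dmin; rewrite /= (asboolT Sr).
  by rewrite leqNgt rd.
exists 0%N => n; split=> [Sn|]; last by rewrite dvd0z => /eqP->; rewrite mulr0z; apply sgS.1.
rewrite dvd0z; apply: contrapT => /negP n0; apply: nex; exists `|n|%N.
rewrite absz_gt0 n0; apply/asboolP; case: n Sn {n0} => n // /(subgroupN sgS).
by rewrite NegzE mulrNz opprK.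
Qed.

(* Divisible groups are injective (Baer), with a partial homomorphism given by
   its graph. *)
Lemma baer_extension (G E : zmodType) (D : set E) (R : G -> E -> Prop) :
  is_subgroup D -> divisible_set D ->
  R 0 0 -> (forall x x' y y', R x y -> R x' y' -> R (x - x') (y - y')) ->
  (forall y, R 0 y -> y = 0) -> (forall x y, R x y -> D y) ->
  exists f : {additive G -> E},
    (forall x y, R x y -> f x = y) /\ forall x, D (f x).
Proof.
move=> sgD divD R0 Rsub Rfn RD.
pose bad := [set z : G * E | (z.1 = 0 /\ z.2 <> 0) \/ ~ D z.2].
have [||V [sgV RV Vbad Vmax]] := @zorn_subgroup (G * E)%type [set z | R z.1 z.2] bad.
- by split=> // -[x y] [x' y']; apply: Rsub.
- by move=> [x y] /= Rxy [[/= x0 y0]|/=]; [apply/y0/Rfn; rewrite -x0 | apply; apply: RD Rxy].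
have Vfn y : V (0, y) -> y = 0.
  by move=> /Vbad h; apply: contrapT => y0; apply: h; left.
have VD x y : V (x, y) -> D y.
  by move=> /Vbad h; apply: contrapT => y0; apply: h; right.
have tot x : exists y, V (x, y).
  pose S := [set x | exists y, V (x, y)].
  have sgS : is_subgroup S.
    split; first by exists 0; apply sgV.1.
    by move=> u v [y Vy] [z Vz]; exists (y - z); apply: sgV.2 Vy Vz.
  have [d Sd] := order_mod_subgroup x sgS.
  (* The value for [x]: divide the value at [d x] by [d], or take [0] if [d = 0]. *)
  have [b Db Vb] : exists2 b, D b & V (x *+ d, b *+ d).
    have [y Vy] := (Sd d).2 (dvdzz _).
    case: d Vy {Sd} => [|d] Vy; first by exists 0; [apply sgD.1 | apply sgV.1].
    have [b Db yE] := divD d.+1 y isT (VD _ _ Vy).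
    by exists b => //; rewrite -yE.
  (* Adjoining [(x, b)] keeps [V] single-valued: if [k x] is in the domain, then [d] divides [k], so
     [k (x, b)] is already in [V]. *)
  pose U := [set z | exists k : int, V (z - (x, b) *~ k)].
  suff UV : U `<=` V.
    by exists b; apply: UV; exists 1; rewrite mulr1z subrr; apply sgV.1.
  apply: Vmax.
  - split; first by exists 0; rewrite mulr0z subr0; apply sgV.1.
    move=> u v [k Vk] [l Vl]; exists (k - l).
    have -> : u - v - (x, b) *~ (k - l) = (u - (x, b) *~ k) - (v - (x, b) *~ l).
      by rewrite mulrzBr !opprD !opprK addrACA.
    by apply sgV.2.
  - by move=> z Vz; exists 0; rewrite mulr0z subr0.
  - have mulnE (z : G * E) n : z *+ n = (z.1 *+ n, z.2 *+ n).
      by elim: n => // n IHn; rewrite !mulrS IHn.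
    have mulzE (z : G * E) (k : int) : z *~ k = (z.1 *~ k, z.2 *~ k).
      by case: k => n; rewrite ?NegzE ?mulrNz -!pmulrn mulnE.
    move=> [u y] [k Vk]; rewrite /bad /= => -[[u0 y0]|nDy].
      apply: y0; rewrite {}u0 in Vk; apply: Vfn.
      have /(Sd _).1/dvdzP[q kE] : S (x *~ k).
        exists (- (y - b *~ k)); have := subgroupN sgV Vk; rewrite mulzE /=.
        have -> : - ((0, y) - (x *~ k, b *~ k)) = (- (0 - x *~ k), - (y - b *~ k)).
          by [].
        by rewrite sub0r opprK.
      rewrite -(subrK ((x, b) *~ k) (0, y)); apply: subgroupD => //.
      have -> : (x, b) *~ k = (x *+ d, b *+ d) *~ q.
        by rewrite kE (mulrC q) mulrzA -[in RHS](mulnE (x, b)).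
      exact: subgroupMz.
    apply: nDy; rewrite -(subrK (b *~ k) y); apply: subgroupD => //.
      by apply: (VD (u - x *~ k)); rewrite mulzE in Vk.
    exact: subgroupMz.
have [||f fV] := @additive_of_relation G E (fun x y => V (x, y)) tot.
- by move=> x x' y y' h h'; apply: sgV.2 h h'.
- exact: Vfn.
exists f; split=> [x y /(RV (x, y)) Vxy|x]; last exact: VD (fV x).
apply/eqP; rewrite -subr_eq0; apply/eqP/Vfn.
by rewrite -(subrr x); apply: sgV.2 (fV x) Vxy.
Qed.

(** * High subgroups and absolute direct summands *)

Lemma exists_high (G : zmodType) (A W : zmodClosed G) :
  trivial_meet W A -> exists2 V : zmodClosed G, high A V & {subset W <= V}.
Proof.
move=> WA; pose bad := [set x : G | x \in A /\ x <> 0].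
have meetP (U : zmodClosed G) :
    trivial_meet U A <-> forall x, x \in U -> ~ bad x.
  split=> [UA x Ux [Ax x0]|UA x].
    by apply: x0; apply/eqP; have := UA x; rewrite !inE Ux Ax => <-.
  rewrite !inE; apply/andP/eqP=> [[Ux Ax]|->]; last by rewrite !rpred0.
  by apply: contrapT => x0; apply: (UA x).
have [|V0 [sgV WV Vbad Vmax]] := zorn_subgroup (subgroup_zmodClosed W) (bad := bad).
  exact/meetP.
have [V VP] := zmodClosed_of_subgroup sgV.
exists V => [|x Wx]; last by apply/VP/WV.
split; first by apply/meetP => x /VP; apply: Vbad.
move=> U VU /meetP UA x; apply/idP/idP => [Ux|/VU//].
apply/VP/(Vmax _ (subgroup_zmodClosed U)) => // y Vy.
by apply/VU/VP.
Qed.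

Lemma exists_complement (G : zmodType) (A : zmodClosed G) :
  absolute_direct_summand A -> exists V : zmodClosed G, direct_sum A V.
Proof.
move=> absA; have sg0 : is_subgroup [set 0 : G].
  by split=> // x y -> ->; rewrite subr0.
have [W WP] := zmodClosed_of_subgroup sg0.
have [|V highV _] := @exists_high G A W; last by exists V; apply: absA.
move=> x; rewrite !inE; apply/andP/eqP => [[/WP]//|->].
by rewrite !rpred0.
Qed.

(* If [G = A + V] with [V] containing [x *+ p - e], then [e] is [p] times the
   [A]-component of [x]. *)
Lemma abs_summand_obstruction (G : zmodType) (A : zmodClosed G) (p : nat) (e x : G) :
  absolute_direct_summand A -> e \in A -> (forall a, a \in A -> e <> a *+ p) ->
  ~ (forall n : int, x *+ p *~ n \in A -> (x *+ p - e) *~ n = 0).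
Proof.
move=> absA Ae pNe ann.
have [W WP] := zmodClosed_of_subgroup (subgroup_multiples (x *+ p - e)).
have [|V /absA [AV sumAV] WV] := @exists_high G A W.
  move=> y; rewrite !inE; apply/andP/eqP => [[/WP[n ->] Ay]|->]; last by rewrite !rpred0.
  apply: ann; rewrite -(subrK (e *~ n) (_ *~ n)) -mulrzBl.
  by apply: rpredD => //; apply: rpredMz.
have [a [v [Aa Vv xE]]] := sumAV x.
apply: (pNe a Aa); apply/eqP; rewrite -subr_eq0.
have := AV (e - a *+ p); rewrite !inE => <-; apply/andP; split.
  by rewrite rpredB // rpredMn.
have -> : e - a *+ p = v *+ p - (x *+ p - e).
  by rewrite xE mulrnDl opprB opprD addrCA [v *+ p + _]addrCA subrr addr0.
by rewrite rpredB ?rpredMn //; apply: WV; apply/WP; exists 1.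
Qed.

(** * Quotients and embeddings into them *)

Section Quotients.
Variables (G : zmodType) (N : zmodClosed G).

Definition proj (x : G) : {quot N} := \pi x.

Lemma proj_eq x y : proj x = proj y <-> x - y \in N.
Proof. by rewrite Quotient.idealrBE; split=> /eqP. Qed.

Lemma projB : zmod_morphism proj.
Proof. by move=> x y; apply: raddfB. Qed.

HB.instance Definition _ := GRing.isZmodMorphism.Build G {quot N} proj projB.

Lemma proj0 : proj 0 = 0.
Proof. exact: raddf0. Qed.

Lemma proj_eq0 x : proj x = 0 <-> x \in N.
Proof. by rewrite -proj0 proj_eq subr0. Qed.

Lemma proj_surj (y : {quot N}) : exists x, proj x = y.
Proof. by exists (repr y); rewrite /proj reprK. Qed.

Lemma projMn x n : proj (x *+ n) = proj x *+ n.
Proof. exact: raddfMn. Qed.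

End Quotients.

Arguments proj {G} N x.
Arguments proj_surj {G N} y.

(** Compose [G -> G/H] with the isomorphism of [G/H] with a complement [V], then with [V -> G/H'],
    injective because [V] meets [H'] trivially. *)
Lemma injects_subgroup (G : zmodType) (H H' : zmodClosed G) :
  absolute_direct_summand H -> {subset H' <= H} ->
  injects G {quot H} -> injects G {quot H'}.
Proof.
move=> /exists_complement[V [HV sumHV]] H'H [f f_inj].
have HV0 v : v \in V -> v \in H -> v = 0.
  by move=> Vv Hv; apply/eqP; have := HV v; rewrite !inE Hv Vv => <-.
have [|||g gP] := @additive_of_relation G {quot H'}
    (fun x y => exists2 v, v \in V & proj H v = f x /\ proj H' v = y).
- move=> x; have [z fx] := proj_surj (f x).
  have [h [v [Hh Vv zE]]] := sumHV z.
  exists (proj H' v), v => //; split=> //.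
  by rewrite -fx; apply/proj_eq; rewrite zE opprD addrCA subrr addr0 rpredN.
- move=> x x' y y' [v Vv [fx <-]] [v' Vv' [fx' <-]]; exists (v - v').
    exact: rpredB.
  by rewrite !projB raddfB fx fx'.
- move=> y [v Vv [/eqP]]; rewrite raddf0 => /eqP/proj_eq0 Hv <-.
  by rewrite (HV0 v) // proj0.
exists g => x y gxy; apply: f_inj; apply/eqP; rewrite -subr_eq0 -raddfB.
have [v Vv [fv gv]] := gP (x - y).
rewrite -fv (HV0 v) // ?proj0 //; apply/H'H/proj_eq0.
by rewrite gv raddfB gxy subrr.
Qed.

(* The embedding sends [x] to the class of [x + c], which does not depend on the
   choice of [c]. *)
Lemma kernel_of_dominated_pair (G E : zmodType) (s j : {additive G -> E})
    (C H : zmodClosed G) :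
  (forall x, x \in C -> j x = 0 -> x = 0) ->
  (forall x, exists2 c, c \in C & s (x + c) = j x) ->
  (forall x, x \in H <-> x \in C /\ s x = 0) ->
  injects G {quot H}.
Proof.
move=> jinj sj HP.
have [|||g gP] := @additive_of_relation G {quot H}
    (fun x y => exists2 c, c \in C & s (x + c) = j x /\ proj H (x + c) = y).
- by move=> x; have [c Cc sc] := sj x; exists (proj H (x + c)), c.
- move=> x x' y y' [c Cc [sc <-]] [c' Cc' [sc' <-]].
  exists (c - c'); first exact: rpredB.
  by rewrite addrACA -opprD projB !raddfB sc sc'.
- move=> y [c Cc [sc <-]]; apply/proj_eq0/HP.
  by rewrite add0r in sc *; rewrite sc raddf0.
exists g => x y gxy; apply/eqP; rewrite -subr_eq0; apply/eqP.
have [c Cc [sc gc]] := gP (x - y).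
have : proj H (x - y + c) = 0 by rewrite gc raddfB gxy subrr.
move/proj_eq0/HP => [Cxy]; rewrite sc; apply: jinj.
by rewrite -(addrK c (x - y)) rpredB.
Qed.

(** * Consequences of the absolutely generalized Bassian property *)

Lemma cyclic_subgroup (G : zmodType) (e : G) :
  exists A : zmodClosed G, forall x, x \in A <-> exists k : int, x = e *~ k.
Proof. exact: zmodClosed_of_subgroup (subgroup_multiples e). Qed.

(** Otherwise dividing by 2 shows that an odd integer kills [e], and dividing by that integer gives
    [e = 0]. *)
Lemma cyclic_not_divisible (G : zmodType) (e : G) : e <> 0 ->
  exists2 p : nat, (0 < p)%N & forall k : int, e <> e *~ k *+ p.
Proof.
move=> e0; apply: contrapT => h.
have div p : (0 < p)%N -> exists k : int, e = e *~ k *+ p.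
  by move=> p0; apply: contrapT => /forallNP ek; apply: h; exists p.
have [k ek] := div 2%N isT.
have: e *~ (k * 2%:Z - 1) = 0.
  by rewrite mulrzBr mulrzA -[_ *~ 2%:Z]/(_ *+ 2) -ek mulr1z subrr.
have : k * 2%:Z - 1 != 0 by apply/eqP; lia.
move: (_ - 1) => n n0 en0; have [|l el] := div `|n|%N; first by rewrite absz_gt0.
apply: e0; rewrite el pmulrn -mulrzA.
by rewrite abszEsg (mulrC l) (mulrC (sgz n)) -mulrA mulrzA en0 mul0rz.
Qed.

Lemma subgroup_gcd (G : zmodType) (S : set G) (x : G) (m : nat) (n : int) :
  is_subgroup S -> S (x *+ m) -> S (x *~ n) -> S (x *+ gcdn m `|n|).
Proof.
move=> sgS Sm Sn; have [d Sd] := order_mod_subgroup x sgS.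
have := (Sd m%:Z).1 Sm; have := (Sd n).1 Sn; rewrite !dvdzE /= => dn dm.
by rewrite pmulrn; apply/Sd; rewrite dvdzE /= dvdn_gcd dm.
Qed.

Lemma subgroup_coprime (G : zmodType) (S : set G) (x : G) (p : nat) (n : int) :
  is_subgroup S -> prime p -> ~~ (p %| n)%Z -> S (x *+ p) -> S (x *~ n) -> S x.
Proof.
move=> sgS p_pr pNn Sp Sn; have := subgroup_gcd sgS Sp Sn.
by rewrite (eqP (_ : coprime p `|n|)) // prime_coprime.
Qed.

Lemma agB_subgroup (G : zmodType) (H H' : zmodClosed G) :
  absolutely_generalized_Bassian G -> injects G {quot H} ->
  {subset H' <= H} -> injects G {quot H'} /\ absolute_direct_summand H'.
Proof.
move=> agB GH H'H.
have GH' := injects_subgroup (agB H GH) H'H GH.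
by split=> //; apply: agB.
Qed.

(** A nonzero [x] in [H] spans a cyclic [A] such that [G] embeds in [G/A]. An element of infinite
    order gives a [y] of infinite order modulo [A], and the obstruction applies to [y] and [x]. *)
Lemma agB_nontorsion_Bassian (G : zmodType) :
  absolutely_generalized_Bassian G -> ~ torsion_group G -> Bassian G.
Proof.
move=> agB ntG H GH x; rewrite !inE; apply/idP/eqP => [Hx|->]; last exact: rpred0.
apply: contrapT => x0; have [A AP] := cyclic_subgroup x.
have [|[f f_inj] absA] := @agB_subgroup G H A agB GH.
  by move=> _ /AP[k ->]; apply: rpredMz.
have [p p0 pNx] := cyclic_not_divisible x0.
have [z ntz] : exists z : G, forall n, (0 < n)%N -> z *+ n <> 0.
  apply: contrapT => /forallNP tG; apply: ntG; apply/seteqP; split=> // z _.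
  have /existsNP[n] := tG z.
  by move=> /not_implyP[n0 /contrapT zn]; exists n.
have [y fy] := proj_surj (f z).
apply: (@abs_summand_obstruction G A p x y absA).
- by apply/AP; exists 1.
- by move=> _ /AP[k ->].
- move=> n An; suff -> : n = 0 by rewrite mulr0z.
  apply: contrapT => /eqP n0.
  have /proj_eq0 : y *+ (p * `|n|)%N \in A.
    rewrite pmulrn PoszM abszEsg mulrCA mulrC mulrzA.
    by rewrite mulrzA in An *; apply: rpredMz.
  rewrite projMn fy -raddfMn -(raddf0 f) => /f_inj; apply: ntz.
  by rewrite muln_gt0 p0 absz_gt0.
Qed.

(** With [A] spanned by [e], suppose [p^2 x = 0] and [p x] is nonzero. If [p x] is in [A], then [e]
    is divisible by [p] in [G], impossible for a direct summand of order [p]; otherwise the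
    obstruction applies. *)
Lemma agB_elementary (G : zmodType) (H : zmodClosed G) (p : nat) (e : G) :
  absolutely_generalized_Bassian G -> injects G {quot H} -> prime p ->
  e \in H -> e *+ p = 0 -> e <> 0 -> elementary_component G p.
Proof.
move=> agB GH p_pr He pe0 e0; have [A AP] := cyclic_subgroup e.
have [|_ absA] := @agB_subgroup G H A agB GH.
  by move=> _ /AP[k ->]; apply: rpredMz.
have Ae : e \in A by apply/AP; exists 1.
have pA a : a \in A -> a *+ p = 0.
  by move=> /AP[k ->]; rewrite pmulrn -mulrzA mulrC mulrzA -pmulrn pe0 mul0rz.
have p2 (x : G) : x *+ p *+ p = 0 -> x *+ p = 0.
  move=> ppx; apply: contrapT => px0.
  have sgA := subgroup_zmodClosed A.
  have [/AP[k pxE]|nApx] := boolP (x *+ p \in A).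
    have [V [AV sumAV]] := exists_complement absA.
    pose S := [set y : G | exists z : G, y = z *+ p].
    have sgS : is_subgroup S.
      split; first by exists 0; rewrite mul0rn.
      by move=> y z [y' ->] [z' ->]; exists (y' - z'); rewrite mulrnBl.
    have [z ez] : S e.
      apply: (@subgroup_coprime G S e p k) => //; last by exists x.
        apply/negP => /dvdzP[q kE]; apply: px0.
        by rewrite pxE kE mulrC mulrzA -[_ *~ p]/(_ *+ p) pe0 mul0rz.
      by rewrite pe0; apply sgS.1.
    have [a [v [Aa Vv zE]]] := sumAV z.
    apply: e0; apply/eqP; have := AV e; rewrite !inE Ae => <- /=.
    by rewrite ez zE mulrnDl (pA a) // add0r rpredMn.
  apply: (@abs_summand_obstruction G A p e x absA Ae).
    by move=> a /pA->.
  (* Here [p x] has order [p] modulo [A], and [p] kills [p x - e]. *)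
  move=> n; have [/dvdzP[q ->] _|pNn] := boolP (p %| n)%Z.
    by rewrite mulrC mulrzA -[_ *~ p]/(_ *+ p) mulrnBl ppx pe0 subrr mul0rz.
  move=> Anpx; case/negP: nApx.
  apply: (subgroup_coprime sgA p_pr pNn) => //=.
  by rewrite ppx rpred0.
apply/seteqP; split=> [_ [x [_ [k xk]] <-]|_ ->] /=; last first.
  by exists 0; rewrite ?mul0rn //; split; exists 1; rewrite ?mul0rn.
elim: k x xk => [|k IHk] x xk; first by rewrite (_ : x = 0) ?mul0rn //; rewrite expn0 in xk.
by rewrite p2 // IHk // -mulrnA -expnS.
Qed.

(** * Primary components *)

Section PrimaryComponents.
Variable G : zmodType.

Lemma primary_componentP p (x : G) : prime p ->
  primary_component G p x <-> exists k : nat, x *+ (p ^ k)%N = 0.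
Proof.
move=> p_pr; split=> [[]//|[k xk]]; split; last by exists k.
by exists (p ^ k)%N; rewrite expn_gt0 prime_gt0.
Qed.

Lemma subgroup_primary p : prime p -> is_subgroup (primary_component G p).
Proof.
move=> p_pr; split; first by apply/primary_componentP => //; exists 0%N.
move=> x y /(primary_componentP _ p_pr)[k xk] /(primary_componentP _ p_pr)[l yl].
apply/primary_componentP => //; exists (k + l)%N.
by rewrite mulrnBl expnD mulrnA xk mul0rn mulnC mulrnA yl mul0rn subrr.
Qed.

(* [u] is the idempotent of the [p]-part modulo [n]: it is [1] modulo the
   [p]-part of [n] and [0] modulo the [p']-part. *)
Lemma primary_projection (x : G) (n p k : nat) : prime p -> (0 < n)%N ->
  x *+ n = 0 ->
  exists u : nat, primary_component G p (x *+ u) /\ (u = 1 %[mod p ^ k])%N.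
Proof.
move=> p_pr n0 xn.
have pv : coprime (p ^ (k + logn p n)) (n`_p^')%N.
  by rewrite coprimeXl // prime_coprime // -p'natE // part_pnat.
exists (chinese (p ^ (k + logn p n)) (n`_p^')%N 1 0); split.
  apply/primary_componentP => //; exists (logn p n).
  have /dvdnP[q ->] : (n`_p^' %| chinese (p ^ (k + logn p n)) n`_p^' 1 0)%N.
    by rewrite /dvdn chinese_modr // mod0n.
  rewrite -mulrnA -mulnA -p_part (mulnC (n`_p^')%N) partnC // mulnC mulrnA xn.
  by rewrite mul0rn.
have := chinese_modl pv 1 0; set u := chinese _ _ _ _ => uE.
by rewrite -(modn_dvdm u (_ : p ^ k %| p ^ (k + logn p n))%N) ?uE ?modn_dvdm //;
   rewrite expnD dvdn_mulr.
Qed.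

Lemma mulrn_modn (x : G) m a b : x *+ m = 0 -> (a = b %[mod m])%N ->
  x *+ a = x *+ b.
Proof.
move=> xm ab; rewrite (divn_eq a m) (divn_eq b m) ab !mulrnDr.
by rewrite !(mulnC _ m) !mulrnA xm !mul0rn.
Qed.

(** Removing from [x] its [p]-component, for a prime [p] dividing [n], leaves an element killed by
    the [p']-part of [n]. *)
Lemma torsion_primary_ind (S : set G) : is_subgroup S ->
  (forall p x, prime p -> primary_component G p x -> S x) ->
  forall x, torsion_part G x -> S x.
Proof.
move=> sgS prim x [n [n0]]; elim/ltn_ind: n n0 x => n IHn n0 x xn.
have [n1|n1] := leqP n 1.
  by rewrite (_ : n = 1%N) in xn; [rewrite -(mulr1n x) xn; apply sgS.1 | lia].
pose p := pdiv n; have p_pr : prime p by rewrite pdiv_prime.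
have [u [xu u1]] := primary_projection (logn p n) p_pr n0 xn.
rewrite -(subrK (x *+ u) x); apply: subgroupD (prim _ _ p_pr xu) => //.
apply: (IHn (n`_p^')%N).
- rewrite -{2}(partnC p n0) ltn_Pmull ?part_gt0 // p_part.
  by rewrite (ltn_exp2l 0) ?prime_gt1 // logn_gt0 mem_primes p_pr n0 pdiv_dvd.
- exact: part_gt0.
- have : x *+ (n`_p^')%N *+ (p ^ logn p n) = 0.
    by rewrite -mulrnA -p_part mulnC partnC.
  move=> /mulrn_modn/(_ u1); rewrite mulr1n -!mulrnA => xE.
  by rewrite mulrnBl -[x *+ u *+ _]mulrnA (mulnC u) xE subrr.
Qed.

End PrimaryComponents.

(** * Sufficiency of the two conditions *)

(** Finitely many translates of [K], one for each value of [f], cover [A]. *)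
Lemma finite_set_fibers (G : zmodType) (T : Type) (A K : set G) (f : G -> T) :
  finite_set [set f x | x in A] -> finite_set K ->
  (forall x y, A x -> A y -> f x = f y -> K (x - y)) -> finite_set A.
Proof.
move=> finF finK fK.
have /choice[g gP] : forall t : T, exists x0, (exists2 x, A x & f x = t) -> A x0 /\ f x0 = t.
  move=> t; case: (pselect (exists2 x, A x & f x = t)) => [[x Ax fx]|n]; last by exists 0.
  by exists x.
pose h (z : T * G) := g z.1 + z.2.
apply: sub_finite_set (finite_image h (finite_setX finF finK)) => x Ax.
have [Ag fg] : A (g (f x)) /\ f (g (f x)) = f x by apply: gP; exists x.
exists (f x, x - g (f x)); last by rewrite /h /= addrC subrK.
by split=> /=; [exists x | apply: fK].
Qed.

Lemma uniq_map_inj (T U : eqType) (f : T -> U) (s : seq T) :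
  uniq (map f s) -> {in s &, injective f}.
Proof.
move=> us x y xs ys fxy; have x0 := x.
have := nth_uniq (f x0) (s := map f s) (i := index x s) (j := index y s).
rewrite size_map !index_mem => /(_ xs ys us).
rewrite !(nth_map x0) ?index_mem // !nth_index // fxy eqxx => /esym/eqP ixy.
by rewrite -(nth_index x0 xs) ixy nth_index.
Qed.

(** The embedding sends [T_p] into the [p]-torsion of [G/H], which the image of [T_p] covers; by
    counting, the projection is injective on [T_p]. *)
Lemma finite_component_meet (G : zmodType) (H : zmodClosed G) (p : nat) (x : G) :
  torsion_group G -> prime p -> finite_set (primary_component G p) ->
  injects G {quot H} -> primary_component G p x -> x \in H -> x = 0.
Proof.
move=> torG p_pr /finite_seqP[s0 s0E] [f f_inj] Tx Hx.
pose s := undup s0.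
have sE y : y \in s <-> primary_component G p y by rewrite mem_undup s0E.
have us : uniq (map (proj H) s).
  apply: (@leq_size_uniq _ (map f s)); rewrite ?size_map //.
    by rewrite map_inj_uniq // undup_uniq.
  move=> _ /mapP[y /sE/(primary_componentP _ p_pr)[k yk] ->].
  (* Multiplying a lift by [u] moves it into [T_p] and keeps its class, which [p ^ k] kills. *)
  have [z zE] := proj_surj (f y).
  have [n [n0 zn]] : torsion_part G z by rewrite torG.
  have [u [Tu u1]] := primary_projection k p_pr n0 zn.
  apply/mapP; exists (z *+ u); first exact/sE.
  rewrite projMn zE -[LHS]mulr1n; apply/esym/(mulrn_modn _ u1).
  by rewrite -raddfMn yk raddf0.
apply: (uniq_map_inj us); [exact/sE | | ].
  by apply/sE; apply (subgroup_primary G p_pr).1.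
by rewrite proj0; apply/proj_eq0.
Qed.

Lemma torsion_elementary_or_finite_agB (G : zmodType) :
  torsion_elementary_or_finite G -> absolutely_generalized_Bassian G.
Proof.
move=> [torG compG] H GH V [VH Vmax].
have HV0 x : x \in H -> x \in V -> x = 0.
  by move=> Hx Vx; apply/eqP; have := VH x; rewrite !inE Hx Vx => <-.
split; first by move=> x; have := VH x; rewrite !inE andbC.
pose S := [set x : G | exists a v : G, [/\ a \in H, v \in V & x = a + v]].
have sgS : is_subgroup S.
  split; first by exists 0, 0; rewrite !rpred0 addr0.
  move=> _ _ [a [v [Ha Vv ->]]] [b [w [Hb Vw ->]]]; exists (a - b), (v - w).
  by rewrite !rpredB //; split=> //; rewrite opprD addrACA.
have SV x : x \in V -> S x by move=> Vx; exists 0, x; rewrite rpred0 add0r.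
have SH x : x \in H -> S x by move=> Hx; exists x, 0; rewrite rpred0 addr0.
(* By maximality of [V], adjoining [x] creates a nonzero element of [H]. *)
have meet x : x \notin V -> exists n : int, exists2 v, v \in V &
    v + x *~ n \in H /\ v + x *~ n <> 0.
  move=> nVx; apply: contrapT => nmeet.
  have [W WP] : exists W : zmodClosed G, forall z, z \in W <->
      exists n : int, exists2 v, v \in V & z = v + x *~ n.
    apply: (@zmodClosed_of_subgroup G
      [set z | exists n : int, exists2 v, v \in V & z = v + x *~ n]).
    split; first by exists 0, 0; rewrite ?rpred0 // mulr0z addr0.
    move=> _ _ [n [v Vv ->]] [m [w Vw ->]]; exists (n - m), (v - w).
      exact: rpredB.
    by rewrite mulrzBr opprD addrACA.
  case/negP: nVx; rewrite -(Vmax W).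
  - by apply/WP; exists 1, 0; rewrite ?rpred0 // add0r mulr1z.
  - by move=> v Vv; apply/WP; exists 0, v; rewrite // mulr0z addr0.
  - move=> z; rewrite !inE; apply/andP/eqP => [[/WP[n [v Vv zE]] Hz]|->].
      by apply: contrapT => z0; apply: nmeet; exists n, v => //; rewrite -zE.
    by rewrite !rpred0.
(* Here [n] is prime to [p], as otherwise [v + n y] would lie in both [V] and [H]. So [y] is in
   [H + V], and [v + n y] has order [p]. *)
have step p y : prime p -> y *+ p \in V -> y \notin V ->
    S y /\ exists2 h, h \in H & h *+ p = 0 /\ h <> 0.
  move=> p_pr Vpy nVy; have [n [v Vv [Hh h0]]] := meet y nVy.
  have pNn : ~~ (p %| n)%Z.
    apply/negP => /dvdzP[q nE]; apply: h0; apply: HV0 => //.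
    by rewrite rpredD // nE mulrC mulrzA rpredMz.
  split.
    apply: (subgroup_coprime sgS p_pr pNn); first exact: SV.
    by rewrite -(addKr v (y *~ n)) addrC; apply: sgS.2; [apply: SH | apply: SV].
  exists (v + y *~ n) => //; split=> //; apply: HV0; first by rewrite rpredMn.
  rewrite mulrnDl; apply: rpredD; first exact: rpredMn.
  by rewrite pmulrn -mulrzA (mulrC n) mulrzA; apply: rpredMz.
have prim p x : prime p -> primary_component G p x -> S x.
  move=> p_pr Tx; have [elem|fin] := compG p p_pr.
    have [/SV//|nVx] := boolP (x \in V); apply: (step p x p_pr _ nVx).1.
    have : [set x *+ p | x in primary_component G p] (x *+ p) by exists x.
    by rewrite elem => ->; apply: rpred0.
  (* For finite [T_p], [H] has no element of order [p], so [step] puts [T_p] inside [V] by induction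
     on the exponent. *)
  apply: SV; have [_ [k]] := Tx; elim: k x {Tx} => [|k IHk] x xk.
    by rewrite -[x]mulr1n xk rpred0.
  have Vpx : x *+ p \in V by apply: IHk; rewrite -mulrnA -expnS.
  apply: contrapT => /negP /(step p x p_pr Vpx)[_ [h Hh [hp]]]; apply.
  apply: (finite_component_meet torG p_pr fin GH) Hh.
  by apply/(primary_componentP _ p_pr); exists 1%N; rewrite expn1.
move=> x; apply: (torsion_primary_ind sgS prim).
by rewrite torG.
Qed.

(** Here [H = 0], so [V] is all of [G] by maximality. *)
Lemma Bassian_agB (G : zmodType) : Bassian G -> absolutely_generalized_Bassian G.
Proof.
move=> BG H /BG H0 V [VH Vmax].
have [W WP] := @zmodClosed_of_subgroup G setT (conj I (fun _ _ _ _ => I)).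
have VT x : x \in V.
  rewrite -(Vmax W) ?WP // => [y _|y]; first by apply/WP.
  by rewrite !inE (WP y).2 //=; have := H0 y; rewrite !inE.
split; last by move=> x; exists 0, x; rewrite rpred0 add0r.
by move=> x; rewrite !inE VT andbT; have := H0 x; rewrite !inE.
Qed.

(** * Infinite primary components with finite socle *)

(** For prime [p] this is the socle of [p^k T_p], since such a [y] lies in [T_p]. *)
Definition socle_at (G : zmodType) (p k : nat) : set G :=
  [set x | x *+ p = 0 /\ exists y, x = y *+ (p ^ k)%N].
Arguments socle_at G p k : clear implicits.

Section FiniteSocle.
Variables (G : zmodType) (p : nat).
Hypothesis p_pr : prime p.

Lemma exists_order_p (x : G) k : x *+ (p ^ k)%N = 0 -> x <> 0 ->
  exists i, x *+ (p ^ i)%N <> 0 /\ x *+ (p ^ i)%N *+ p = 0.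
Proof.
elim: k => [|k IHk] xk x0; first by case: x0; rewrite -[x]mulr1n xk.
case: (pselect (x *+ (p ^ k)%N = 0)) => [/IHk|xk0]; first exact.
by exists k; split=> //; rewrite -mulrnA -expnSr.
Qed.

Hypothesis fin0 : finite_set (socle_at G p 0).

Lemma finite_pow_torsion k : finite_set [set x : G | x *+ (p ^ k)%N = 0].
Proof.
elim: k => [|k IHk].
  apply: sub_finite_set (finite_set1 0) => x /= xk.
  by rewrite -[x]mulr1n.
apply: (@finite_set_fibers G G _ (socle_at G p 0) (fun x => x *+ p)) => //.
  apply: sub_finite_set IHk => _ [x /= xk <-] /=.
  by rewrite -mulrnA -expnS.
move=> x y _ _ xy; split; first by rewrite mulrnBl xy subrr.
by exists (x - y); rewrite expn0.
Qed.

(** The socles decrease with [k]; each of finitely many elements stays forever or drops out at some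
    stage, and [K] bounds these stages. *)
Lemma socle_stabilizes :
  exists K, forall x, socle_at G p K x -> forall k, socle_at G p k x.
Proof.
have mono k l (x : G) : (k <= l)%N -> socle_at G p l x -> socle_at G p k x.
  move=> kl [px [y xE]]; split=> //.
  exists (y *+ (p ^ (l - k))%N); by rewrite xE -mulrnA -expnD subnK.
have /finite_seqP[s sE] := fin0.
have [K KP] : exists K, forall x, x \in s -> socle_at G p K x ->
    forall k, socle_at G p k x.
  elim: s {sE} => [|a s [K IHK]]; first by exists 0%N.
  case: (pselect (forall k, socle_at G p k a)) => [ha|/existsNP[k nk]].
    by exists K => x; rewrite inE => /orP[/eqP-> _|] //; apply: IHK.
  exists (maxn k K) => x; rewrite inE => /orP[/eqP->|xs] xK.
    by case: nk; apply: mono xK; apply: leq_maxl.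
  by apply: IHK => //; apply: mono xK; apply: leq_maxr.
exists K => x xK; apply: KP => //.
by have := mono 0%N K x (leq0n _) xK; rewrite sE.
Qed.

(* Once the socles of the groups [p ^ k T_p] are constant, every element of the
   socle has infinite height. *)
Lemma divisible_of_finite_socle :
  exists K, divisible_set [set x | exists2 y, primary_component G p y & x = y *+ (p ^ K)%N].
Proof.
have [K KP] := socle_stabilizes; exists K; set C := [set x | _].
have sgT := subgroup_primary G p_pr.
have sgC : is_subgroup C.
  split; first by exists 0; [apply sgT.1 | rewrite mul0rn].
  by move=> _ _ [x Tx ->] [y Ty ->]; exists (x - y); [apply: sgT.2 | rewrite mulrnBl].
have CT x : C x -> exists n, x *+ (p ^ n)%N = 0.
  move=> [y Ty ->]; apply/(primary_componentP _ p_pr).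
  exact: subgroupMn.
have divp x : C x -> exists2 c, C c & x = c *+ p.
  move=> Cx; have [n xn] := CT x Cx; elim: n x Cx xn => [|n IHn] x Cx xn.
    by exists 0; [apply sgC.1 | rewrite mul0rn -[x]mulr1n].
  have : socle_at G p K (x *+ (p ^ n)%N).
    split; first by rewrite -mulrnA -expnSr.
    have [y _ ->] := Cx; exists (y *+ (p ^ n)%N).
    by rewrite -!mulrnA mulnC.
  (* This height is chosen so that [p^n] kills [x - p (p^K z)]. *)
  move=> /KP/(_ (K.+1 + n)%N)[_ [z zE]].
  have Cz : C (z *+ (p ^ K)%N).
    exists z => //; apply/primary_componentP => //; exists (K.+1 + n + 1)%N.
    by rewrite expnD mulrnA -zE -mulrnA -expnSr xn.
  have [||c Cc cE] := IHn (x - z *+ (p ^ K)%N *+ p).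
  - by apply: sgC.2 => //; apply: subgroupMn.
  - by rewrite mulrnBl zE -!mulrnA expnD expnSr ?mulnA subrr.
  exists (c + z *+ (p ^ K)%N); first exact: subgroupD.
  by rewrite mulrnDl -cE subrK.
have divpn n x : C x -> exists2 c, C c & x = c *+ (p ^ n)%N.
  elim: n x => [|n IHn] x Cx; first by exists x.
  have [c Cc ->] := divp x Cx; have [d Cd ->] := IHn c Cc.
  by exists d; rewrite // -mulrnA -expnSr.
move=> n x n0 Cx; have [k xk] := CT x Cx.
have [c Cc cE] := divpn (logn p n) x Cx.
have [l cl] := CT c Cc.
have cop : coprime (p ^ l) (n`_p^')%N.
  by rewrite coprimeXl // prime_coprime // -p'natE // part_pnat.
(* The quotient [q] inverts the [p']-part of [n] modulo [p ^ l], which kills [c]. *)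
have /dvdnP[q qE] : (n`_p^' %| chinese (p ^ l) n`_p^' 1 0)%N.
  by rewrite /dvdn chinese_modr // mod0n.
exists (c *+ q); first exact: subgroupMn.
rewrite -mulrnA -(partnC p n0) mulnCA -qE mulnC mulrnA p_part cE.
rewrite [in RHS](_ : c *+ _ = c) //.
by rewrite -[RHS]mulr1n; apply: (mulrn_modn cl); rewrite chinese_modl.
Qed.

(** With [C = p^K T_p] divisible and [r] a retraction of [G] onto [C], the pair [s = p r], [j = r]
    gives [H = C[p]]. *)
Lemma kernel_of_finite_socle : infinite_set (primary_component G p) ->
  exists (H : zmodClosed G) (e : G),
    [/\ injects G {quot H}, e \in H, e *+ p = 0 & e <> 0].
Proof.
move=> infT; have [K divC] := divisible_of_finite_socle.
move: divC; set C := [set x | _] => divC.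
have sgT := subgroup_primary G p_pr.
have sgC : is_subgroup C.
  split; first by exists 0; [apply sgT.1 | rewrite mul0rn].
  by move=> _ _ [x Tx ->] [y Ty ->]; exists (x - y); [apply: sgT.2 | rewrite mulrnBl].
have [e [Ce pe e0]] : exists e, [/\ C e, e *+ p = 0 & e <> 0].
  apply: contrapT => ne; apply: infT.
  apply: sub_finite_set (finite_pow_torsion K) => x Tx /=.
  apply: contrapT => x0; have /(primary_componentP _ p_pr)[k xk] := Tx.
  have [|i [ei pei]] := @exists_order_p (x *+ (p ^ K)%N) k _ x0.
    by rewrite -mulrnA mulnC mulrnA xk mul0rn.
  apply: ne; exists (x *+ (p ^ K)%N *+ (p ^ i)%N); split=> //.
  by apply: subgroupMn => //; exists x.
have [||||r [rC Cr]] := @baer_extension G G C (fun x y => C x /\ y = x) sgC divC.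
- by split=> //; apply sgC.1.
- by move=> x x' y y' [Cx ->] [Cx' ->]; split=> //; apply: sgC.2.
- by move=> y [].
- by move=> x y [Cx ->].
have [|||s sE] := @additive_of_relation G G (fun x y => y = r x *+ p).
- by move=> x; exists (r x *+ p).
- by move=> x x' y y' -> ->; rewrite raddfB mulrnBl.
- by move=> y ->; rewrite raddf0 mul0rn.
have [C' C'P] := zmodClosed_of_subgroup sgC.
have [|H HP] := @zmodClosed_of_subgroup G [set x | x \in C' /\ s x = 0].
  split; first by rewrite /= raddf0 rpred0.
  by move=> x y [Cx sx] [Cy sy]; split; rewrite ?rpredB // raddfB sx sy subrr.
have rid x : C x -> r x = x by move=> Cx; apply: rC.
exists H, e; split=> //; last by apply/HP; split; [exact/C'P | rewrite sE rid].
apply: (@kernel_of_dominated_pair G G s r C' H) => //.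
  by move=> x /C'P Cx; rewrite rid.
move=> x.
(* The equation [p c = r x - p r x] says that [s (x + c) = r x]. *)
have [||c Cc cE] := divC p (r x - r x *+ p).
- exact: prime_gt0.
- by apply: sgC.2 => //; apply: subgroupMn.
exists c; first exact/C'P.
by rewrite sE raddfD (rid c) // mulrnDl -cE addrC subrK.
Qed.

End FiniteSocle.

(** * The quasi-cyclic group as a quotient of the rationals *)

Section LocalizedIntegers.
Variable p : nat.
Hypothesis p_pr : prime p.

(* The localization of the integers at [p], so that the quotient of [rat] by it
   is the quasi-cyclic [p]-group. *)
Definition p_integral : set rat :=
  [set x | exists2 d : nat, ~~ (p %| d)%N & exists z : int, x *+ d = z%:~R].

Lemma subgroup_p_integral : is_subgroup p_integral.
Proof.
split; first by exists 1%N; [rewrite dvdn1; case: eqP p_pr => // -> | exists 0; rewrite mul0rn].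
move=> x y [d pd [z xz]] [e pe [w yw]]; exists (d * e)%N.
  by rewrite Euclid_dvdM // negb_or pd.
exists (z *+ e - w *+ d); rewrite mulrnBl mulrnA xz mulnC mulrnA yw.
by rewrite rmorphB !rmorphMn.
Qed.

Let ppos r : (p ^ r)%:R != 0 :> rat.
Proof. by rewrite pnatr_eq0 -lt0n expn_gt0 prime_gt0. Qed.

Lemma p_integral_div (k : int) n :
  p_integral (k%:~R / (p ^ n)%:R) <-> ((p ^ n)%N %| k)%Z.
Proof.
split=> [[d pd [z kz]]|/dvdzP[q ->]]; last first.
  exists 1%N; first by rewrite dvdn1; case: eqP p_pr => // ->.
  by exists q; rewrite mulr1n intrM -[(Posz _)%:~R]/((p ^ n)%:R) mulfK.
have : k * d%:Z = z * (p ^ n)%:Z.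
  apply: (@intr_inj rat); rewrite !intrM -kz -[_ *+ d]mulr_natr mulrAC.
  by rewrite -[(Posz (p ^ n))%:~R]/((p ^ n)%:R) mulfVK.
move=> kd; have : ((p ^ n)%N %| k * d%:Z)%Z by rewrite kd dvdz_mull.
by rewrite Gauss_dvdzl // coprimezE /= coprimeXl // prime_coprime.
Qed.

Lemma p_integral_mulrn x m : p_integral x -> p_integral (x *+ m).
Proof. by move=> xp; apply: (subgroupMn subgroup_p_integral). Qed.

(** So the class of [1 / p^r] generates the [p^r]-torsion. From [d x = z / p^r] and
    [u d + v p^r = 1] follows [d (x - z u / p^r) = z v]. *)
Lemma p_integral_approx x r : p_integral (x *+ p ^ r) ->
  exists k : int, p_integral (x - k%:~R / (p ^ r)%:R).
Proof.
move=> [d pd [z xz]].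
have [u [v uvE]] : exists u v : int, u * d%:Z + v * (p ^ r)%:Z = 1.
  have := Bezoutz d%:Z (p ^ r)%:Z.
  have -> : gcdz d (p ^ r)%N = 1.
    rewrite /gcdz /=; congr Posz; apply/eqP.
    by rewrite -/(coprime _ _) coprime_sym coprimeXl // prime_coprime.
  by move=> [u [v uv]]; exists u, v.
exists (z * u); exists d => //; exists (z * v).
have xE : x *+ d = z%:~R / (p ^ r)%:R.
  by rewrite -xz -mulrnA mulnC mulrnA -[X in X / _]mulr_natr mulfK.
have vE : v%:~R = (1 - u%:~R * d%:R) / (p ^ r)%:R :> rat.
  have uv : u%:~R * d%:R + v%:~R * (p ^ r)%:R = 1 :> rat.
    by have /(congr1 (fun k : int => k%:~R : rat)) := uvE; rewrite rmorphD !rmorphM.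
  apply: (mulIf (ppos r)); rewrite mulfVK //.
  by apply/eqP; rewrite eq_sym subr_eq addrC uv.
rewrite mulrnBl xE !rmorphM /= vE -[(_ / _) *+ d]mulr_natr.
by field; apply: ppos.
Qed.

Lemma p_integral_pow x : exists r, p_integral (x *+ p ^ r).
Proof.
pose n := `|denq x|%N; exists (logn p n); exists (n`_p^')%N.
  by rewrite -p'natE // part_pnat.
exists (numq x); rewrite -mulrnA -p_part partnC ?absz_gt0 ?denq_neq0 //.
rewrite -mulr_natr -[X in _ * X]/((Posz n)%:~R) absz_denq.
by rewrite -[X in X * _]divq_num_den mulfVK // intr_eq0 denq_neq0.
Qed.

End LocalizedIntegers.

(** * Direct sums of cyclic groups *)

Section Combinations.
Variable V : zmodType.

(** Polynomials serve as finitely supported integer sequences. *)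
Definition comb (v : nat -> V) (a : {poly int}) : V :=
  \sum_(i < size a) v i *~ a`_i.

Lemma comb_widen v (a : {poly int}) n : (size a <= n)%N ->
  comb v a = \sum_(i < n) v i *~ a`_i.
Proof.
move=> an; rewrite /comb (big_ord_widen _ (fun i => v i *~ a`_i) an).
rewrite big_mkcond; apply: eq_bigr => i _; case: ltnP => // ai.
by rewrite nth_default // mulr0z.
Qed.

Lemma combB v a b : comb v (a - b) = comb v a - comb v b.
Proof.
pose n := maxn (size a) (size b).
rewrite !(@comb_widen _ _ n) ?leq_maxl ?leq_maxr //.
  by rewrite -sumrB; apply: eq_bigr => i _; rewrite coefB mulrzBr.
by rewrite (leq_trans (size_polyD _ _)) // size_polyN.
Qed.

Lemma comb0 v : comb v 0 = 0.
Proof. by rewrite /comb size_poly0 big_ord0. Qed.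

Lemma combCX v (k : int) i : comb v (k *: 'X^i) = v i *~ k.
Proof.
rewrite (@comb_widen _ _ i.+1).
  rewrite (bigD1 ord_max) //= coefZ coefXn eqxx mulr1 big1 ?addr0 // => j.
  by rewrite -val_eqE /= => /negPf ji; rewrite coefZ coefXn ji mulr0 mulr0z.
by rewrite (leq_trans (size_scale_leq _ _)) // size_polyXn.
Qed.

Lemma comb_eq0 v (a : {poly int}) : (forall i, v i *~ a`_i = 0) -> comb v a = 0.
Proof. by move=> h; apply: big1. Qed.

End Combinations.

Lemma raddf_comb (V W : zmodType) (f : {additive V -> W}) v a :
  f (comb v a) = comb (fun i => f (v i)) a.
Proof. by rewrite raddf_sum; apply: eq_bigr => i _; rewrite raddfMz. Qed.

(* [c] generates the direct sum of the cyclic groups of order [p ^ t i], which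
   meets [N G] trivially. *)
Definition independent_family (G : zmodType) (p N : nat) (t : nat -> nat)
    (c : nat -> G) : Prop :=
  (forall i, c i *+ (p ^ t i)%N = 0) /\
  forall (a : {poly int}) g, comb c a = g *+ N -> forall i, ((p ^ t i)%N %| a`_i)%Z.

Lemma mulrz_dvd (G : zmodType) (x : G) (m : nat) (k : int) :
  x *+ m = 0 -> (m %| k)%Z -> x *~ k = 0.
Proof. by move=> xm /dvdzP[q ->]; rewrite mulrC mulrzA -pmulrn xm mul0rz. Qed.

(** By independence, sending [comb c a + N g] to [comb u a] is well defined; the extension to [G]
    kills [N G]. *)
Lemma hom_of_family (G E : zmodType) (p N : nat) t (c : nat -> G) (u : nat -> E) :
  independent_family p N t c -> divisible_set [set: E] ->
  (forall i, u i *+ (p ^ t i)%N = 0) ->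
  exists f : {additive G -> E},
    (forall i, f (c i) = u i) /\ forall x, f x *+ N = 0.
Proof.
move=> [ct ind] divE ut.
pose R (x : G) (y : E) := exists (a : {poly int}) (g : G),
  x = comb c a + g *+ N /\ y = comb u a.
have [|||||f [fR _]] := @baer_extension G E setT R _ divE.
- by [].
- by exists 0, 0; rewrite !comb0 mul0rn addr0.
- move=> x x' y y' [a [g [-> ->]]] [b [h [-> ->]]]; exists (a - b), (g - h).
  by rewrite !combB mulrnBl opprD addrACA.
- move=> y [a [g [/esym/eqP]]]; rewrite addr_eq0 -mulNrn => /eqP/ind da ->.
  by apply: comb_eq0 => i; apply: mulrz_dvd (ut i) (da i).
- by [].
exists f; split=> [i|x].
  apply: fR; exists (1 *: 'X^i), 0.
  by rewrite !combCX !mulr1z mul0rn addr0.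
rewrite -raddfMn; apply: fR; exists 0, x.
by rewrite !comb0 add0r.
Qed.

Lemma subgroup_p_integral_coefs p : prime p ->
  is_subgroup [set q : {poly rat} | forall i, p_integral p q`_i].
Proof.
move=> p_pr; have sg := subgroup_p_integral p_pr.
split=> [i|q r qi ri i]; first by rewrite coef0; apply sg.1.
by rewrite coefB; apply: sg.2.
Qed.

(* [E] below is a countable direct sum of quasi-cyclic [p]-groups.  Sending the
   [i]-th generator to ['X^i / p ^ t i] embeds the family; sending generator [0]
   to [0] and generator [i.+1] to ['X^(b i) / p ^ t i.+1] has a nontrivial kernel
   and still reaches the whole [N]-torsion of [E]. *)
Lemma kernel_of_independent_family (G : zmodType) (p N : nat)
    (t b : nat -> nat) (c : nat -> G) :
  prime p -> (0 < t 0)%N -> independent_family p N t c ->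
  (forall k x, p_integral p (x *+ N) ->
     exists2 i, b i = k & p_integral p (x *+ (p ^ t i.+1)%N)) ->
  exists (H : zmodClosed G) (e : G),
    [/\ injects G {quot H}, e \in H, e *+ p = 0 & e <> 0].
Proof.
move=> p_pr t0 fam cover; have [ct ind] := fam.
have sgI := subgroup_p_integral p_pr.
have ppos r : (p ^ r)%:R != 0 :> rat by rewrite pnatr_eq0 -lt0n expn_gt0 prime_gt0.
have [L LP] := zmodClosed_of_subgroup (subgroup_p_integral_coefs p_pr).
pose E := {quot L}.
have divE : divisible_set [set: E].
  move=> n y n0 _; have [q <-] := proj_surj y.
  exists (proj L (n%:R^-1 *: q)) => //; rewrite -projMn.
  by rewrite -scaler_nat scalerA mulfV ?scale1r // pnatr_eq0 -lt0n.
pose gen i r : E := proj L ((p ^ r)%:R^-1 *: 'X^i).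
have genMz i r (k : int) : gen i r *~ k = proj L ((k%:~R / (p ^ r)%:R) *: 'X^i).
  by rewrite -raddfMz -scaler_int scalerA.
have genpow i r : gen i r *+ (p ^ r)%N = 0.
  rewrite pmulrn genMz; apply/proj_eq0/LP => j; rewrite coefZ coefXn mulr_natr.
  by apply: p_integral_mulrn => //; apply/p_integral_div.
have [j [jc jN]] := hom_of_family fam divE (u := fun i => gen i (t i)) (fun i => genpow _ _).
pose us i := if i is i'.+1 then gen (b i') (t i) else 0.
have [|s [sc sN]] := hom_of_family fam divE (u := us).
  by case=> [|i] /=; [rewrite mul0rn | exact: genpow].
have [C CP] : exists C : zmodClosed G, forall x, x \in C <-> exists a, x = comb c a.
  apply: (@zmodClosed_of_subgroup G [set x | exists a, x = comb c a]).
  split; first by exists 0; rewrite comb0.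
  by move=> _ _ [a ->] [a' ->]; exists (a - a'); rewrite combB.
have [|H HP] := @zmodClosed_of_subgroup G [set x | x \in C /\ s x = 0].
  split; first by rewrite /= raddf0 rpred0.
  by move=> x y [Cx sx] [Cy sy]; split; rewrite ?rpredB // raddfB sx sy subrr.
have cC i k : c i *~ k \in C by apply/CP; exists (k *: 'X^i); rewrite combCX.
(* An element of order [p] in the cyclic group of [c 0], on which [s] vanishes. *)
exists H, (c 0 *~ (p ^ (t 0).-1)%N); split.
- apply: (@kernel_of_dominated_pair G E s j C H) => //.
    move=> _ /CP[a ->]; rewrite raddf_comb => ja; apply: comb_eq0 => i.
    apply: mulrz_dvd (ct i) _; apply/(p_integral_div p_pr).
    have : comb (fun i => j (c i)) a =
        proj L (\sum_(i < size a) ((a`_i)%:~R / (p ^ t i)%:R) *: 'X^i).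
      rewrite [RHS]raddf_sum; apply: eq_bigr => l _.
      by rewrite jc genMz.
    rewrite ja => /esym/proj_eq0/LP/(_ i).
    rewrite -(poly_def (size a) (fun i => (a`_i)%:~R / (p ^ t i)%:R)) coef_poly.
    case: ltnP => // ai _; rewrite nth_default // mul0r; apply sgI.1.
  move=> x; have [q qE] := proj_surj (j x - s x).
  have qN i : p_integral p (q`_i *+ N).
    have : proj L (q *+ N) = 0 by rewrite projMn qE mulrnBl jN sN subrr.
    by move=> /proj_eq0/LP/(_ i); rewrite coefMn.
  suff [y Cy sy] : exists2 y, y \in C & s y = proj L q.
    by exists y => //; rewrite raddfD sy qE addrC subrK.
  rewrite -[q]coefK poly_def.
  elim/big_ind: _ => [|u v [y Cy sy] [z Cz sz]|i _].
  + by exists 0; rewrite ?rpred0 // raddf0 proj0.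
  + exists (y + z); first exact: rpredD.
    by rewrite raddfD sy sz; apply/esym; apply: raddfD.
  (* By [cover], [s] sends some generator to a class of large enough order at this monomial; a
     multiple of it gives the coefficient. *)
  have [l bl /(p_integral_approx p_pr)[k ki]] := cover i q`_i (qN i).
  exists (c l.+1 *~ k); first exact: cC.
  rewrite raddfMz sc /= genMz; apply/proj_eq/LP => m.
  rewrite bl -scalerBl coefZ coefXn mulr_natr.
  by apply: p_integral_mulrn => //; rewrite -opprB; apply: (subgroupN sgI).
- apply/HP; split; first exact: cC.
  by rewrite raddfMz sc mul0rz.
- by rewrite -pmulrn -mulrnA -expnSr prednK.
- move=> e0; have := ind ((p ^ (t 0).-1)%N%:Z *: 'X^0) 0.
  rewrite combCX e0 mul0rn => /(_ erefl 0%N).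
  rewrite coefZ coefXn mulr1 dvdzE /= dvdn_Pexp2l ?prime_gt1 //.
  by rewrite -ltnS prednK // ltnn.
Qed.

(** [B] contains [p^s x], where [p^s] is the gcd of [p^(r+1)] and [k]; [s <= r] would put [p^r x] in
    [B]. *)
Lemma subgroup_pow_dvd (G : zmodType) (B : set G) (x : G) (p r : nat) (k : int) :
  is_subgroup B -> prime p -> x *+ (p ^ r.+1)%N = 0 -> ~ B (x *+ (p ^ r)%N) ->
  B (x *~ k) -> ((p ^ r.+1)%N %| k)%Z.
Proof.
move=> sgB p_pr xp nB Bk.
have : B (x *+ gcdn (p ^ r.+1) `|k|) by apply: subgroup_gcd => //; rewrite xp; apply sgB.1.
have /(dvdn_pfactor _ _ p_pr)[s sr gE] := dvdn_gcdl (p ^ r.+1) `|k|.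
rewrite gE => Bs; have [sltr|rs] := ltnP s r.+1.
  case: nB; rewrite -(subnKC (sltr : s <= r)%N) expnD mulrnA.
  exact: subgroupMn.
by rewrite dvdzE /= (@dvdn_trans (p ^ s)) ?dvdn_exp2l // -gE dvdn_gcdr.
Qed.

(** Greedy choice: [B i], spanned by [N G] and the first [i] generators, keeps a finite [p]-socle,
    so some [p^(n i) c] in the infinite socle lies outside [B i]. *)
Lemma exists_independent_family (G : zmodType) (p N : nat) (n : nat -> nat) :
  prime p -> finite_set [set x : G | x *+ p = 0 /\ exists g, x = g *+ N] ->
  (forall i, infinite_set (socle_at G p (n i))) ->
  exists c : nat -> G, independent_family p N (fun i => (n i).+1) c.
Proof.
move=> p_pr finN infn.
pose good (B : set G) := is_subgroup B /\ finite_set [set x | x *+ p = 0 /\ B x].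
have /choice[pick pickP] : forall z : nat * set G, exists c : G, good z.2 ->
    c *+ (p ^ (n z.1).+1)%N = 0 /\ ~ z.2 (c *+ (p ^ n z.1)%N).
  move=> [i B]; case: (pselect (good B)) => [[sgB finB]|]; last by exists 0.
  apply: contrapT => /forallNP nex; apply: (infn i); apply: sub_finite_set finB.
  move=> x /= [px [y xE]]; split=> //; apply: contrapT => nBx.
  apply: (nex y) => _; rewrite expnSr mulrnA -xE; split=> //.
pose fix B i : set G := if i is i'.+1
  then [set x | exists k : int, B i' (x - pick (i', B i') *~ k)]
  else [set x | exists g, x = g *+ N].
pose c i := pick (i, B i).
have goodB i : good (B i).
  elim: i => [|i [sgB finB]].
    split=> //; split; first by exists 0; rewrite mul0rn.
    by move=> _ _ [g ->] [h ->]; exists (g - h); rewrite mulrnBl.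
  have [cp _] : c i *+ (p ^ (n i).+1)%N = 0 /\ ~ B i (c i *+ (p ^ n i)%N).
    exact: (pickP (i, B i)).
  have sgBS : is_subgroup (B i.+1).
    split; first by exists 0; rewrite mulr0z subr0; apply sgB.1.
    move=> x y [k Bx] [l By]; exists (k - l).
    have -> : x - y - c i *~ (k - l) = (x - c i *~ k) - (y - c i *~ l).
      by rewrite mulrzBr !opprD !opprK addrACA.
    exact: sgB.2.
  split=> //.
  (* Modulo [B i], elements of [B i.+1] are multiples of [c i] by residues, so finitely many
     translates cover the new socle. The [.-1.+1] makes the index type nonempty by form. *)
  have /choice[f fP] : forall x, exists r : 'I_(p ^ (n i).+1).-1.+1, B i.+1 x ->
      B i (x - c i *+ r).
    move=> x; case: (pselect (B i.+1 x)) => [[k Bk]|]; last by exists ord0.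
    have m0 : (0 < p ^ (n i).+1)%N by rewrite expn_gt0 prime_gt0.
    exists (inord `|(k %% (p ^ (n i).+1)%N)%Z|%N) => _.
    have mk0 : (0 <= k %% (p ^ (n i).+1)%N)%Z by rewrite modz_ge0 // eqz_nat -lt0n.
    rewrite inordK; last first.
      by rewrite prednK // -ltz_nat gez0_abs // ltz_pmod.
    rewrite pmulrn gez0_abs // /modz mulrzBr.
    rewrite [c i *~ (_ * _)](@mulrz_dvd _ _ _ _ cp) ?dvdz_mull // subr0.
    exact: Bk.
  apply: (@finite_set_fibers G _ _ _ f _ finB); first exact: finite_finset.
  move=> x y [px Bx] [py By] fxy; split; first by rewrite mulrnBl px py subrr.
  rewrite -[x - y](_ : (x - c i *+ f x) - (y - c i *+ f y) = _).
    by apply: sgB.2; apply: fP.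
  by rewrite fxy opprB addrA subrK.
have cP i : c i *+ (p ^ (n i).+1)%N = 0 /\ ~ B i (c i *+ (p ^ n i)%N).
  exact: (pickP (i, B i) (goodB i)).
exists c; split=> [i|a g aE i]; first exact: (cP i).1.
have B0 m x : B 0%N x -> B m x.
  by move=> Bx; elim: m => // m IHm; exists 0; rewrite mulr0z subr0.
have Bc m l : (l < m)%N -> B m (c l).
  elim: m => // m IHm; rewrite ltnS leq_eqVlt => /orP[/eqP->|lm].
    by exists 1; rewrite mulr1z subrr; apply (goodB m).1.1.
  by exists 0; rewrite mulr0z subr0; apply: IHm.
(* The last term lies in [B m], so the order of [c m] divides its coefficient and the term
   vanishes. *)
have ind m : B 0%N (\sum_(l < m) c l *~ a`_l) ->
    forall l, (l < m)%N -> ((p ^ (n l).+1)%N %| a`_l)%Z.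
  elim: m => [//|m IHm]; rewrite big_ord_recr /= => Bsum.
  have dm : ((p ^ (n m).+1)%N %| a`_m)%Z.
    have [sgB _] := goodB m; have [cp nB] := cP m.
    apply: (subgroup_pow_dvd sgB p_pr cp nB).
    rewrite -(addKr (\sum_(l < m) c l *~ a`_l) (c m *~ a`_m)) addrC.
    apply: sgB.2; first exact: B0.
    elim/big_ind: _ => [|x y Bx By|l _]; first exact: sgB.1.
      exact: subgroupD.
    by apply: subgroupMz => //; apply: Bc.
  move=> l; rewrite ltnS leq_eqVlt => /orP[/eqP->//|]; apply: IHm.
  by move: Bsum; rewrite (mulrz_dvd (cP m).1 dm) addr0.
have [ia|ai] := ltnP i (size a); last by rewrite nth_default // dvdz0.
by apply: (ind (size a)) => //; exists g.
Qed.

Lemma kernel_of_infinite_component (G : zmodType) (p : nat) :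
  prime p -> infinite_set (primary_component G p) ->
  exists (H : zmodClosed G) (e : G),
    [/\ injects G {quot H}, e \in H, e *+ p = 0 & e <> 0].
Proof.
move=> p_pr infT.
case: (pselect (exists m, `[< finite_set (socle_at G p m) >])) => [exm|nfin].
  have := ex_minnP exm; case=> -[|m] /asboolP finm mmin.
    exact: kernel_of_finite_socle.
  have infm : infinite_set (socle_at G p m).
    by move=> fin; have := mmin m (asboolT fin); rewrite ltnn.
  (* Here [N = p ^ m.+1] is the common order of the summands. *)
  have [c cP] := exists_independent_family p_pr finm (n := fun=> m) (fun=> infm).
  apply: (kernel_of_independent_family (b := id) p_pr _ cP) => // k x xN.
  by exists k.
have infs i : infinite_set (socle_at G p i).
  by move=> fin; apply: nfin; exists i; apply/asboolP.
have fin0 : finite_set [set x : G | x *+ p = 0 /\ exists g, x = g *+ 0].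
  by apply: sub_finite_set (finite_set1 0) => x [_ [g ->]].
have [c cP] := exists_independent_family p_pr fin0 infs.
(* [logn 2] takes each value [k] at arbitrarily large indices [2^k (2 r + 1)], where the orders
   suffice for [x]. *)
apply: (kernel_of_independent_family (b := logn 2) p_pr _ cP) => // k x _.
have [r xr] := p_integral_pow p_pr x.
exists (2 ^ k * r.*2.+1)%N.
  by rewrite lognM ?expn_gt0 // pfactorK // lognE /= dvdn2 /= odd_double addn0.
have rle : (r <= (2 ^ k * r.*2.+1).+2)%N.
  rewrite -addnn; have : (0 < 2 ^ k)%N by rewrite expn_gt0.
  nia.
rewrite -(subnKC rle) expnD mulrnA.
exact: p_integral_mulrn.
Qed.

Theorem theorem2p8 (G : zmodType) :
  absolutely_generalized_Bassian G <->
  (torsion_elementary_or_finite G \/ Bassian_nontorsion G) /\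
  ~ (torsion_elementary_or_finite G /\ Bassian_nontorsion G).
Proof.
split=> [agB|[[/torsion_elementary_or_finite_agB//|[/Bassian_agB//]] _]].
split; last by move=> [[torG _] [_]].
have [torG|ntorG] := pselect (torsion_group G); last first.
  by right; split=> //; apply: agB_nontorsion_Bassian.
left; split=> // p p_pr; apply: contrapT => /not_orP[nelem infT].
have [H [e [GH He pe e0]]] := kernel_of_infinite_component p_pr infT.
by apply: nelem; apply: agB_elementary GH p_pr He pe e0.
Qed.
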